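(* Let $n\ge 2$, let $G = V_{8n} = \langle x, y : x^{2n} = y^4 = 1,\ yx = x^{-1}y^{-1},\ y^{-1}x = x^{-1}y \rangle$, and let $\mathcal{CCC}(G)$ be its commuting conjugacy class graph. Then: (1) $$\mathrm{Spec}(\mathcal{CCC}(G)) = \begin{cases}\left\{(-1)^{2n - 2}, 0^{2}, (2n - 2)^{1}\right\}, & \text{if } n \text{ is odd},\\ \left\{(-1)^{2n - 1}, 1^{2}, (2n - 3)^{1}\right\}, & \text{if } n \text{ is even},\end{cases}$$ and $$E(\mathcal{CCC}(G)) = \begin{cases}4n - 4, & \text{if } n \text{ is odd},\\ 4n - 2, & \text{if } n \text{ is even}.\end{cases}$$ (2) $$\mathrm{L\text{-}Spec}(\mathcal{CCC}(G)) = \begin{cases}\left\{0^{3}, (2n - 1)^{2n - 2}\right\}, & \text{if } n \text{ is odd},\\ \left\{0^{3}, 2^2, (2n - 2)^{2n - 3}\right\}, & \text{if } n \text{ is even},\end{cases}$$ and $$LE(\mathcal{CCC}(G)) = \begin{cases}\frac{6(2n - 1)(2n - 2)}{2n + 1}, & \text{if } n \text{ is odd},\\ 6, & \text{if } n = 2,\\ \frac{2(2n - 3)(5n - 7)}{n + 1}, & \text{if } n \text{ is even and } n \geq 4.\end{cases}$$ (3) $$\mathrm{Q\text{-}Spec}(\mathcal{CCC}(G)) = \begin{cases}\left\{0^{2}, (4n - 4)^{1}, (2n - 3)^{2n - 2}\right\}, & \text{if } n \text{ is odd},\\ \left\{2^2, 0^{2}, (4n - 6)^{1}, (2n - 4)^{2n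 - 3}\right\}, & \text{if } n \text{ is even},\end{cases}$$ and $$LE^+(\mathcal{CCC}(G)) = \begin{cases}\frac{4(2n - 1)(2n - 2)}{2n + 1}, & \text{if } n \text{ is odd},\\ 6, & \text{if } n = 2,\\ \frac{16(n - 1)(n - 2)}{n + 1}, & \text{if } n \text{ is even and } n \geq 4.\end{cases}$$
   Context: For a finite non-abelian group $G$, the commuting conjugacy class graph $\mathcal{CCC}(G)$ is the simple undirected graph whose vertices are the conjugacy classes of the non-central elements of $G$; two distinct vertices $x^G$ and $y^G$ are adjacent iff there exist $x'\in x^G$ and $y'\in y^G$ with $x'y'=y'x'$. For a finite graph $\mathcal{G}$ with adjacency matrix $A(\mathcal{G})$ and (diagonal) degree matrix $D(\mathcal{G})$, put $L(\mathcal{G})=D(\mathcal{G})-A(\mathcal{G})$ and $Q(\mathcal{G})=D(\mathcal{G})+A(\mathcal{G})$. $\mathrm{Spec}(\mathcal{G})$, $\mathrm{L\text{-}Spec}(\mathcal{G})$, $\mathrm{Q\text{-}Spec}(\mathcal{G})$ are the multisets of eigenvalues of $A(\mathcal{G})$, $L(\mathcal{G})$, $Q(\mathcal{G})$ respectively. In the notation $\{\alpha_1^{a_1},\dots,\alpha_l^{a_l}\}$ the exponent is a multiplicity; if listed values coincide their multiplicities are added. With $d=\frac{2|e(\mathcal{G})|}{|V(\mathcal{G})|}$ ($|V(\mathcal{G})|$ the number of vertices, $|e(\mathcal{G})|$ the number of edges), the energy, Laplacian energy and signless Laplacian energy (sums with multiplicity) are $E(\mathcal{G})=\sum_{\lambda\in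 \mathrm{Spec}(\mathcal{G})}|\lambda|$, $LE(\mathcal{G})=\sum_{\mu\in \mathrm{L\text{-}Spec}(\mathcal{G})}|\mu-d|$, $LE^+(\mathcal{G})=\sum_{\nu\in \mathrm{Q\text{-}Spec}(\mathcal{G})}|\nu-d|$. *)

(* Defs.v *)
From HB Require Import structures.
From mathcomp Require Import all_boot all_order all_algebra all_fingroup all_solvable.

Set Implicit Arguments.
Unset Strict Implicit.
Unset Printing Implicit Defensive.

Import Order.TTheory GRing.Theory Num.Theory.
Local Open Scope ring_scope.

Record sgraph := SGraph {
  vertex : finType;
  adj : rel vertex;
  adj_sym : symmetric adj;
  adj_irrefl : irreflexive adj }.

Arguments adj : clear implicits.

Definition edges (g : sgraph) : {set {set vertex g}} :=
  [set e | [exists u, exists v, adj g u v && (e == [set u; v])]].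

Definition degree (g : sgraph) (u : vertex g) : nat := #|[set v | adj g u v]|.

Section Spectra.

(* All the eigenvalues below are algebraic over Q, so any algebraically closed
   field with a norm (algC, or R[i] for a real closed field R) gives the same
   spectra and energies as the complex numbers. *)
Variable C : numClosedFieldType.

(* The roots of the characteristic polynomial, listed with multiplicity; the
   list is only meaningful up to perm_eq. *)
Definition eigenvalues (m : nat) (A : 'M[C]_m) : seq C :=
  sval (closed_field_poly_normal (char_poly A)).

Variable g : sgraph.

Definition adjacency_mx : 'M[C]_#|vertex g| :=
  \matrix_(i, j) (adj g (enum_val i) (enum_val j))%:R.

Definition degree_mx : 'M[C]_#|vertex g| :=
  diag_mx (\row_i (degree (enum_val i))%:R).

Definition Spec : seq C := eigenvalues adjacency_mx.
Definition LSpec : seq C := eigenvalues (degree_mx - adjacency_mx).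
Definition QSpec : seq C := eigenvalues (degree_mx + adjacency_mx).

Definition avg_degree : C := (2 * #|edges g|)%:R / #|vertex g|%:R.

Definition energy : C := \sum_(l <- Spec) `|l|.
Definition Lenergy : C := \sum_(m <- LSpec) `|m - avg_degree|.
Definition Qenergy : C := \sum_(v <- QSpec) `|v - avg_degree|.

End Spectra.

Section CommutingConjugacyClassGraph.

Local Open Scope group_scope.
Variables (gT : finGroupType) (G : {group gT}).

Definition noncentral_classes : {set {set gT}} :=
  [set x ^: G | x in G :\: 'Z(G)].

Definition ccc_vertex : finType := {X : {set gT} | X \in noncentral_classes}.

Definition ccc_adj : rel ccc_vertex := fun X Y =>
  (X != Y) && [exists x in val X, exists y in val Y, x * y == y * x].

Lemma ccc_adj_sym : symmetric ccc_adj.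
Proof.
move=> X Y; rewrite /ccc_adj eq_sym; congr (_ && _).
by apply/existsP/existsP => -[x /andP[Xx /existsP[y /andP[Yy /eqP xy]]]];
  exists y; rewrite Yy; apply/existsP; exists x; rewrite Xx xy eqxx.
Qed.

Lemma ccc_adj_irrefl : irreflexive ccc_adj.
Proof. by move=> X; rewrite /ccc_adj eqxx. Qed.

Definition CCC : sgraph := SGraph ccc_adj_sym ccc_adj_irrefl.

End CommutingConjugacyClassGraph.

(* The isog-Grp predicate only sees finite quotients of the presented group;
   here the presented group is finite (of order 8n), so the predicate does say
   that G is isomorphic to it. *)
Definition is_V8n (n : nat) (gT : finGroupType) (G : {group gT}) : Prop :=
  (G \isog Grp (x : y : (x ^+ (2 * n) = 1, y ^+ 4 = 1,
                         y * x = x^-1 * y^-1, y^-1 * x = x^-1 * y)))%g.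

(* Main.v *)
Require Import Defs.
From HB Require Import structures.
From mathcomp Require Import all_boot all_order all_algebra all_fingroup all_solvable.
From mathcomp Require Import zify ring.

Import Order.TTheory GRing.Theory Num.Theory.
Local Open Scope ring_scope.

(* With z = y^2, which is central, conjugation by y maps x to x^-1 z, so
   A = <x, z> is abelian of index 2 and B = <x^2, z> has index 2 in A; the
   order 8n is witnessed by a regular permutation representation. Two
   noncentral elements commute up to conjugacy exactly when both lie in A, both
   in B y, or both in (A y) \ (B y): every element of A y is conjugate to some
   x^e z^j y with e in {0, 1}, and two commuting elements outside A differ by a
   central element, hence by an element of B. Counting conjugacy classes in
   the three parts, CCC(G) is a disjoint union of three complete graphs, of
   orders 2n - q, q and q with q = |Z(G)| / 2, i.e. 1 for odd n and 2 for
   even n. *)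

(** * Spectra of disjoint unions of complete graphs *)

(** Factorisations into monic linear factors are unique up to order. The padding [s1] lets a
    determinant identity that holds only after multiplication by extra factors be used without
    dividing polynomials. *)
Lemma perm_eigenvalues (C : numClosedFieldType) m (A : 'M[C]_m) s1 s2 :
  char_poly A * \prod_(c <- s1) ('X - c%:P) = \prod_(c <- s2) ('X - c%:P) ->
  perm_eq (eigenvalues A ++ s1) s2.
Proof.
rewrite /eigenvalues; case: closed_field_poly_normal => r /= ->.
rewrite (monicP (char_poly_monic A)) scale1r -big_cat /=.
exact: prod_XsubC_eq.
Qed.

(* With [N] the incidence matrix of [f] and [D], [D'] the diagonal matrices of
   [a \o f] and [a], the left-hand side is the determinant of
     [ D   -bN ]   [ 1  bN ]
     [ N^T  1  ] * [ 0  D' ],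
   which is block lower triangular because [D * N = N * D']. *)
Lemma det_fibres (R : comNzRingType) m k (f : 'I_m -> 'I_k) (a : 'I_k -> R) (b : R) :
  \det (\matrix_(i, j) ((i == j)%:R * a (f i) + (f i == f j)%:R * b))
    * \prod_l a l =
  (\prod_i a (f i)) * \prod_l (a l + b * #|[set i | f i == l]|%:R).
Proof.
pose N : 'M[R]_(m, k) := \matrix_(i, l) (f i == l)%:R.
pose D := diag_mx (\row_i a (f i)); pose D' := diag_mx (\row_l a l).
have DN : D *m N = N *m D'.
  apply/matrixP => i l; rewrite mul_diag_mx mul_mx_diag !mxE.
  by case: eqP => [->|]; rewrite ?mulr1 ?mul1r ?mulr0 ?mul0r.
have NtN : N^T *m N = diag_mx (\row_l #|[set i | f i == l]|%:R).
  apply/matrixP => l l'; rewrite !mxE -sum1_card natr_sum [in RHS]big_mkcond /=.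
  rewrite -sumrMnl; apply: eq_bigr => i _; rewrite !mxE inE -natrM mulnb.
  case: (f i =P l) => [->|_]; last by rewrite mul0rn.
  by case: eqP.
have eM : \matrix_(i, j) ((i == j)%:R * a (f i) + (f i == f j)%:R * b)
    = D + b *: (N *m N^T).
  apply/matrixP => i j; rewrite !mxE mulr_natl; congr (_ + _).
  rewrite mulrC (bigD1 (f i)) //= !mxE eqxx mul1r eq_sym big1 ?addr0 // => l nl.
  by rewrite !mxE eq_sym (negPf nl) mul0r.
pose P := block_mx D (- (b *: N)) N^T 1%:M.
pose Q : 'M_(m + k) := block_mx 1%:M (b *: N) 0 D'.
have dP : \det P = \det (D + b *: (N *m N^T)).
  have {1}-> : P = block_mx (D + b *: (N *m N^T)) (- (b *: N)) 0 1%:M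
                   *m block_mx 1%:M 0 N^T 1%:M.
    rewrite mulmx_block !mulmx1 !mulmx0 !mul1mx !add0r.
    by rewrite mulNmx -scalemxAl addrK.
  by rewrite det_mulmx det_ublock det_lblock !det1 !mulr1.
have dQ : \det Q = \prod_l a l.
  by rewrite det_ublock det1 mul1r det_diag; apply: eq_bigr => l _; rewrite mxE.
rewrite eM -dP -dQ -det_mulmx mulmx_block !mulmx1 !mulmx0 !addr0 mul1mx.
rewrite -scalemxAr DN mulNmx -scalemxAl subrr det_lblock det_diag.
congr (_ * _); first by apply: eq_bigr => i _; rewrite mxE.
rewrite -scalemxAr NtN.
rewrite (_ : _ + _ = diag_mx (\row_l (a l + b * #|[set i | f i == l]|%:R))).
  by rewrite det_diag; apply: eq_bigr => l _; rewrite mxE.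
apply/matrixP => l l'; rewrite !mxE addrC.
by case: eqP => _; rewrite ?mulr1n // mulr0n mulr0 addr0.
Qed.

(** The matrix ['X - M] has the shape treated in [det_fibres], with entries ['X - a l] and [- b]. A
    fibre with s + 1 elements gives s + 1 factors ['X - a l], one of which cancels against the extra
    product over [l], and one factor whose root is [a l + (s + 1) b]. *)
Lemma perm_eigenvalues_fibres (C : numClosedFieldType) m k (f : 'I_m -> 'I_k)
    (a : 'I_k -> C) (b : C) (size_fibre : 'I_k -> nat) :
  (forall l, #|[set i | f i == l]| = (size_fibre l).+1) ->
  perm_eq
    (eigenvalues (\matrix_(i, j) ((i == j)%:R * a (f i) + (f i == f j)%:R * b)))
    (flatten [seq rcons (nseq (size_fibre l) (a l)) (a l + (size_fibre l).+1%:R * b)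
             | l <- enum 'I_k]).
Proof.
move=> sz; set M := matrix_of_fun _ _.
rewrite -(perm_cat2r [seq a l | l <- enum 'I_k]); apply: perm_eigenvalues.
rewrite big_cat big_flatten !(big_enum, big_map) /=.
have -> : char_poly M = \det (\matrix_(i, j) ((i == j)%:R * ('X - (a (f i))%:P)
                                + (f i == f j)%:R * - b%:P)).
  congr (\det _); apply/matrixP => i j.
  rewrite !mxE polyCD !polyCM !polyC_natr.
  by case: (i == j); rewrite ?(mul1r, mul0r, mulr1n, mulr0n) mulrN opprD addrA ?subr0.
have := det_fibres _ _ _ f (fun l => 'X - (a l)%:P) (- b%:P) => /= ->.
rewrite (partition_big f predT) //=.
rewrite -!big_split /=; apply: eq_bigr => l _.
rewrite -cats1 big_cat big_seq1 big_nseq iter_mulr_1 sz.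
rewrite (eq_bigr (fun=> 'X - (a l)%:P)) => [|i /eqP-> //].
rewrite prodr_const -[#|_|]cardsE sz exprSr -!mulrA; congr (_ * _).
by rewrite mulrC polyCD polyCM polyC_natr opprD addrA mulNr [b%:P * _]mulrC.
Qed.

(** Both sides count ordered adjacent pairs. Grouped by first component they give the degrees;
    grouped by underlying edge, each edge has exactly two orderings because its ends differ. *)
Lemma handshake (g : sgraph) : (2 * #|edges g| = \sum_(u : vertex g) degree u)%N.
Proof.
pose e_of (p : vertex g * vertex g) := [set p.1; p.2].
have sumE : (\sum_(u : vertex g) degree u = \sum_(p | adj g p.1 p.2) 1)%N.
  rewrite -(pair_big_dep predT (fun u v => adj g u v) (fun _ _ => 1%N)) /=.
  by apply: eq_bigr => u _; rewrite sum1_card /degree cardsE.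
rewrite sumE (partition_big e_of (mem (edges g))) /=; last first.
  move=> [u v] uv; rewrite inE; apply/existsP; exists u.
  by apply/existsP; exists v; rewrite uv eqxx.
rewrite mulnC -sum_nat_const; apply: eq_bigr => e.
rewrite inE => /existsP[u /existsP[v /andP[uv /eqP->]]].
have nuv : u != v by apply: contraTneq uv => ->; rewrite adj_irrefl.
have -> : 2%N = #|[set (u, v); (v, u)]|.
  by rewrite cards2 xpair_eqE negb_and nuv.
rewrite -sum1_card; apply: eq_bigl => -[a b]; rewrite /e_of !inE !xpair_eqE /=.
apply/orP/andP => [[]/andP[/eqP-> /eqP->]|[ab /eqP eab]].
- by rewrite uv.
- by rewrite adj_sym uv setUC.
have nab : a != b by apply: contraTneq ab => ->; rewrite adj_irrefl.
have : u \in [set a; b] by rewrite eab set21.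
have : v \in [set a; b] by rewrite eab set22.
rewrite !inE; case/orP=> /eqP ev; case/orP=> /eqP eu; move: nuv;
  rewrite ev eu ?eqxx // => _;
  by [left | right].
Qed.

(** * Spectra and average degree of a disjoint union of complete graphs *)

Section ClusterGraph.

Variables (C : numClosedFieldType) (g : sgraph) (k : nat).
(** [size_fibre l] is one less than the number of vertices in fibre [l]. It is thus the common
    degree in that complete graph, and also the multiplicity of the repeated eigenvalue. *)
Variables (f : vertex g -> 'I_k) (size_fibre : 'I_k -> nat).
Hypothesis adjE : forall u v, adj g u v = (u != v) && (f u == f v).
Hypothesis card_fibre : forall l, #|[set v | f v == l]| = (size_fibre l).+1.

Let fe (i : 'I_#|vertex g|) := f (enum_val i).

Let card_fibre_ord l : #|[set i | fe i == l]| = (size_fibre l).+1.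
Proof.
rewrite -card_fibre -(card_imset _ enum_val_inj); congr #|pred_of_set _|.
apply/setP => v; rewrite inE; apply/imsetP/idP => [[i]|fv].
  by rewrite inE => fi ->.
by exists (enum_rank v); rewrite ?inE /fe enum_rankK.
Qed.

Let degreeE u : degree u = size_fibre (f u).
Proof.
apply: succn_inj; rewrite -card_fibre (cardsD1 u) inE eqxx add1n; congr _.+1.
by apply: eq_card => v; rewrite !inE adjE eq_sym [f v == _]eq_sym.
Qed.

Let adjacencyE : adjacency_mx C g =
  \matrix_(i, j) ((fe i == fe j)%:R - (i == j)%:R).
Proof.
apply/matrixP => i j; rewrite !mxE adjE (inj_eq enum_val_inj) /fe.
by case: eqP => [->|_]; rewrite ?eqxx ?subrr ?subr0.
Qed.

Let degree_mxE : degree_mx C g =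
  \matrix_(i, j) ((i == j)%:R * (size_fibre (fe i))%:R).
Proof. by apply/matrixP => i j; rewrite !mxE degreeE mulr_natl. Qed.

Lemma perm_Spec_cluster :
  perm_eq (Spec C g)
    (flatten [seq rcons (nseq (size_fibre l) (-1)) (size_fibre l)%:R
             | l <- enum 'I_k]).
Proof.
rewrite /Spec adjacencyE.
have -> : \matrix_(i, j) ((fe i == fe j)%:R - (i == j)%:R) =
    \matrix_(i, j) ((i == j)%:R * -1 + (fe i == fe j)%:R * 1) :> 'M[C]__.
  by apply/matrixP => i j; rewrite !mxE mulr1 mulrN1 addrC.
have := perm_eigenvalues_fibres C _ _ fe (fun=> -1) 1 _ card_fibre_ord.
by under eq_map => l do rewrite mulr1 -natr1 addrC addrK.
Qed.

Lemma perm_LSpec_cluster :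
  perm_eq (LSpec C g)
    (flatten [seq rcons (nseq (size_fibre l) (size_fibre l).+1%:R) 0
             | l <- enum 'I_k]).
Proof.
rewrite /LSpec adjacencyE degree_mxE.
have -> : \matrix_(i, j) ((i == j)%:R * (size_fibre (fe i))%:R)
          - \matrix_(i, j) ((fe i == fe j)%:R - (i == j)%:R) =
    \matrix_(i, j) ((i == j)%:R * (size_fibre (fe i)).+1%:R
                    + (fe i == fe j)%:R * -1) :> 'M[C]__.
  by apply/matrixP => i j; rewrite !mxE mulrN1 -natr1 mulrDr mulr1 opprB addrA.
have := perm_eigenvalues_fibres C _ _ fe (fun l => (size_fibre l).+1%:R) (-1) _
  card_fibre_ord.
by under eq_map => l do rewrite mulrN1 subrr.
Qed.

Lemma perm_QSpec_cluster :
  perm_eq (QSpec C g)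
    (flatten [seq rcons (nseq (size_fibre l) ((size_fibre l)%:R - 1))
                        (2 * size_fibre l)%:R
             | l <- enum 'I_k]).
Proof.
rewrite /QSpec adjacencyE degree_mxE.
have -> : \matrix_(i, j) ((i == j)%:R * (size_fibre (fe i))%:R)
          + \matrix_(i, j) ((fe i == fe j)%:R - (i == j)%:R) =
    \matrix_(i, j) ((i == j)%:R * ((size_fibre (fe i))%:R - 1)
                    + (fe i == fe j)%:R * 1) :> 'M[C]__.
  apply/matrixP => i j; rewrite !mxE mulrBr !mulr1 -addrA.
  by congr (_ + _); rewrite addrC.
have := perm_eigenvalues_fibres C _ _ fe (fun l => (size_fibre l)%:R - 1) 1 _
  card_fibre_ord.
by under eq_map => l do
  rewrite mulr1 -natr1 addrACA addNr addr0 -natrD addnn -mul2n.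
Qed.

Lemma avg_degree_cluster :
  avg_degree C g =
  (\sum_l (size_fibre l).+1 * size_fibre l)%:R / (\sum_l (size_fibre l).+1)%:R.
Proof.
rewrite /avg_degree handshake -sum1_card.
congr (_%:R / _%:R); rewrite (partition_big f predT) //=; apply: eq_bigr => l _.
  rewrite -card_fibre cardsE -sum_nat_const; apply: eq_bigr => u /eqP <-.
  exact: degreeE.
by rewrite -card_fibre cardsE sum1_card.
Qed.

End ClusterGraph.

(** * The group of order 8n *)

Section V8nModel.

Local Open Scope group_scope.
Variables (n : nat) (n_gt0 : (0 < n)%N).

Let T := ('Z_(2 * n) * bool * bool)%type.

(* A triple (i, j, k) stands for x^i y^(2j) y^k; the generators act by right
   multiplication, using y x = x^-1 y^2 y with y^2 central. *)
Definition V8n_actx (t : T) : T :=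
  let: (i, j, k) := t in if k then (i - 1, ~~ j, k)%R else (i + 1, j, k)%R.
Definition V8n_acty (t : T) : T :=
  let: (i, j, k) := t in (i, j (+) k, ~~ k).

Lemma V8n_actx_inj : injective V8n_actx.
Proof.
apply: (can_inj (g := fun t : T =>
  let: (i, j, k) := t in if k then (i + 1, ~~ j, k)%R else (i - 1, j, k)%R)).
by move=> [[i j] []]; rewrite /= ?subrK ?addrK ?negbK.
Qed.

Lemma V8n_acty_inj : injective V8n_acty.
Proof.
by move=> [[i []] []] [[i' []] []] //= [] ->.
Qed.

Definition V8n_permx := perm V8n_actx_inj.
Definition V8n_permy := perm V8n_acty_inj.

Lemma V8n_permxX m i j k :
  (V8n_permx ^+ m) (i, j, k) =
  (if k then i - m%:R else i + m%:R, j (+) (k && odd m), k)%R.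
Proof.
elim: m => [|m IHm]; first by rewrite expg0 perm1 andbF addbF subr0 addr0 if_same.
rewrite expgSr permM IHm permE /= -natr1.
by case: k {IHm} => /=; rewrite ?opprD ?addrA // addbN.
Qed.

Lemma V8n_permy2 i j k : (V8n_permy ^+ 2) (i, j, k) = (i, ~~ j, k).
Proof. by rewrite permM !permE /=; case: j; case: k. Qed.

Definition V8n_model := <[V8n_permx]> <*> <[V8n_permy]>.

Lemma V8n_model_homg : V8n_model \homg
  Grp (x : y : (x ^+ (2 * n) = 1, y ^+ 4 = 1,
                y * x = x^-1 * y^-1, y^-1 * x = x^-1 * y)).
Proof.
have y2 := V8n_permy2.
apply/existsP; exists (V8n_permx, V8n_permy).
rewrite /= !xpair_eqE eqxx /=.
(* The last two relations are first put in the inverse-free forms x y x y = 1 and x y^3 x = y, which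
   can be evaluated point by point; y^-1 = y^3 then restores the original form. *)
have yxy : V8n_permx * V8n_permy * V8n_permx * V8n_permy = 1.
  by apply/permP => -[[i []] []]; rewrite !permM !permE /= ?permM ?permE /= ?subrK ?addrK.
have y4 : V8n_permy ^+ 4 = 1.
  apply/permP => -[[i j] k].
  by rewrite (expgM _ 2 2) expgS expg1 permM !y2 perm1 negbK.
have xyyyx : V8n_permx * (V8n_permy * V8n_permy ^+ 2) * V8n_permx = V8n_permy.
  by apply/permP => -[[i []] []]; rewrite !permM !permE /= ?permM ?permE /= ?subrK ?addrK.
apply/and4P; split; apply/eqP.
- apply/permP => -[[i j] k]; rewrite V8n_permxX perm1 pchar_Zp; last first.
    by rewrite mul2n -addnn; case: (n) n_gt0 => // m _; rewrite addnS.
  by rewrite oddM andbF addbF subr0 addr0 if_same.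
- exact: y4.
- by apply: (mulgI V8n_permx); apply: (mulIg V8n_permy); rewrite mulgA yxy mulKVg mulVg.
- apply: (mulgI V8n_permx); rewrite mulKVg -[RHS]xyyyx -mulgA.
  by congr (_ * (_ * _)); rewrite -[LHS]mulg1 -y4 expgS mulKg.
Qed.

(** The orbit of the base point (0, false, false) is all of [T]: the point (i, j, k) is its image
    under x^i y^(2j) y^k. *)
Lemma V8n_model_card : (8 * n <= #|V8n_model|)%N.
Proof.
have -> : (8 * n)%N = #|{: T}|.
  rewrite !card_prod card_bool card_ord Zp_cast; last first.
    by case: (n) n_gt0 => // m; rewrite mulnS.
  by rewrite -!mulnA [(n * 4)%N]mulnC mulnA.
pose h (s : {perm T}) := s (0%R, false, false).
have -> : #|{: T}| = #|h @: V8n_model|.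
  apply: eq_card => t; rewrite inE; symmetry; apply/imsetP.
  case: t => [[i j] k].
  exists (V8n_permx ^+ i * V8n_permy ^+ (2 * j) * V8n_permy ^+ k).
    by rewrite !groupM ?groupX ?mem_gen // inE cycle_id ?orbT.
  rewrite /h !permM V8n_permxX /= add0r natr_Zp.
  by case: j; case: k; rewrite ?(expg0, perm1, V8n_permy2, expg1) // permE.
exact: leq_imset_card.
Qed.

End V8nModel.

(** * Normal forms, subgroups and orders in G *)

Section V8nStructure.

Local Open Scope group_scope.
Variables (n : nat) (gT : finGroupType) (G : {group gT}) (x y : gT).
Hypotheses (n_ge2 : (2 <= n)%N) (genG : <[x]> <*> <[y]> = G)
  (xn1 : x ^+ (2 * n) = 1) (y41 : y ^+ 4 = 1)
  (yx : y * x = x^-1 * y^-1) (yVx : y^-1 * x = x^-1 * y)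
  (leG : (8 * n <= #|G|)%N).

Let z := y ^+ 2.
(** One family covers all the subgroups in use: A is [H 1], B is [H 2], and the centre will be
    [H m]. *)
Let H d := <[x ^+ d]> <*> <[z]>.

Let Gx : x \in G. Proof. by rewrite -genG mem_gen // inE cycle_id. Qed.
Let Gy : y \in G. Proof. by rewrite -genG mem_gen // inE cycle_id orbT. Qed.

Let z2 : z ^+ 2 = 1. Proof. by rewrite -expgM. Qed.
Let cyz : commute y z. Proof. exact: commuteX. Qed.

(** The relations say y x y = x^-1 and y x^-1 y = x, so z x z = y (y x y) y = x, and z is an
    involution or trivial. *)
Let cxz : commute x z.
Proof.
have e1 : y * x * y = x^-1 by rewrite yx mulgKV.
have e2 : y * x^-1 * y = x.
  by apply: invg_inj; rewrite !invMg invgK mulgA yVx mulgK.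
have zxz : z * x * z = x by rewrite -[RHS]e2 -e1 /z expgS expg1 !mulgA.
by rewrite /commute -{1}zxz -mulgA (z2 : z * z = 1) mulg1.
Qed.

Let xJy : x ^ y = x^-1 * z.
Proof. by rewrite conjgE mulgA yVx -mulgA. Qed.

Let xXJy i : (x ^+ i) ^ y = x ^- i * z ^+ i.
Proof.
rewrite conjXg xJy expgMn ?expgVn //.
by apply/commute_sym/commuteV/commute_sym.
Qed.

Let cxzX i j : commute (x ^+ i) (z ^+ j).
Proof. exact/commuteX/commute_sym/commuteX/commute_sym. Qed.

Let mul_yxX i : y * x ^+ i = x ^- i * z ^+ i * y.
Proof.
apply: (mulIg (z ^- i)).
rewrite -[RHS]mulgA (commuteV (commuteX i cyz)) mulgA mulgK.
by rewrite [RHS]conjgC conjVg xXJy invMg invgK -(commuteV (cxzX i i)) mulgA.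
Qed.

Let HP d a : reflect (exists i j, a = x ^+ (d * i) * z ^+ j) (a \in H d).
Proof.
rewrite /H cent_joinEr; last first.
  rewrite cycle_subG; apply/centP => _ /cycleP[i ->].
  by rewrite -expgM; apply/commute_sym/(cxzX _ 1).
apply: (iffP mulsgP) => [[_ _ /cycleP[i ->] /cycleP[j ->] ->]|[i [j ->]]].
  by exists i, j; rewrite expgM.
by exists (x ^+ (d * i)) (z ^+ j); rewrite ?expgM ?mem_cycle.
Qed.

Let zH d j : z ^+ j \in H d.
Proof. by apply/HP; exists 0%N, j; rewrite muln0 mul1g. Qed.

Let H_sub_G d : H d \subset G.
Proof. by rewrite join_subG !cycle_subG !groupX. Qed.

Let A := H 1.

Let AP a : reflect (exists i j, a = x ^+ i * z ^+ j) (a \in A).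
Proof. by apply: (iffP (HP 1 a)) => -[i [j ->]]; exists i, j; rewrite mul1n. Qed.

Let A_comm a b : a \in A -> b \in A -> commute a b.
Proof.
move=> /AP[i [j ->]] /AP[k [l ->]]; apply: commuteM; apply: commute_sym.
  by apply: commuteM; [apply/commuteX/commute_sym/commuteX | apply: cxzX].
apply: commuteM; last exact/commuteX/commute_sym/commuteX.
exact/commute_sym/cxzX.
Qed.

(** Since y normalises A, G is the product of A and [<[y]>]; as y^2 = z lies in A, only the parity
    of the exponent of y matters. *)
Let G_split g : g \in G -> (g \in A) || (g * y^-1 \in A).
Proof.
have nAy : <[y]> \subset 'N(A).
  rewrite cycle_subG inE sub_conjg; apply/subsetP => a; rewrite mem_conjg invgK.
  move=> /AP[i [j ->]]; rewrite conjMg xXJy [_ ^ y]conjgE.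
  rewrite -(commuteX j cyz) mulKg !groupM ?groupV ?zH //.
  by apply/AP; exists i, 0%N; rewrite mulg1.
have -> : G = A * <[y]> :> {set gT}.
  rewrite -norm_joinEr // -genG /A /H expg1 -joingA [<[z]> <*> _]joingC.
  by congr (_ <*> _); apply/esym/joing_idPl; rewrite cycle_subG mem_cycle.
case/mulsgP => a _ Aa /cycleP[k ->] ->.
rewrite -(odd_double_half k) addnC expgD -mul2n expgM -/z.
case: (odd k) => /=; last by rewrite mulg1 groupM ?zH.
by rewrite expg1 mulgA mulgK [X in _ || X]groupM ?zH ?orbT.
Qed.

Let G_sub : G \subset A :|: A :* y.
Proof. by apply/subsetP => g /G_split; rewrite inE mem_rcoset. Qed.

Let AE : A = <[x]> * <[z]> :> {set gT}.
Proof.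
rewrite /A /H expg1 cent_joinEr // cycle_subG.
by apply/centP => _ /cycleP[i ->]; apply/commute_sym/(cxzX _ 1).
Qed.

(** The relations give only upper bounds, but their product is 8n, so the lower bound [leG] forces
    equality in each of them. *)
Let orders : [/\ #[x] = (2 * n)%N, #[z] = 2%N, #|A| = (4 * n)%N & #|G| = (8 * n)%N].
Proof.
have ox : (#[x] <= 2 * n)%N by rewrite dvdn_leq ?order_dvdn ?xn1 //; lia.
have oz : (#[z] <= 2)%N by rewrite dvdn_leq ?order_dvdn ?z2.
have oA : (#|A| <= #[x] * #[z])%N.
  by rewrite /order (mul_cardG <[x]> <[z]>) AE leq_pmulr // cardG_gt0.
have oG : (#|G| <= 2 * #|A|)%N.
  apply: leq_trans (subset_leq_card G_sub) _; apply: leq_trans (leq_card_setU _ _) _.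
  by rewrite card_rcoset mul2n addnn.
by split; nia.
Qed.

Let ox : #[x] = (2 * n)%N. Proof. by case: orders. Qed.
Let oz : #[z] = 2%N. Proof. by case: orders. Qed.
Let oA : #|A| = (4 * n)%N. Proof. by case: orders. Qed.
Let oG : #|G| = (8 * n)%N. Proof. by case: orders. Qed.

Let tixz : <[x]> :&: <[z]> = 1.
Proof.
apply: card1_trivg; have := mul_cardG <[x]> <[z]>.
rewrite -AE oA -!/(#[_]) ox oz /=; move: #|_ :&: _| => k; nia.
Qed.

Let xz_eq1 i j : x ^+ i * z ^+ j = 1 -> (2 * n %| i)%N /\ (2 %| j)%N.
Proof.
move=> e; have zj : z ^+ j = 1.
  apply/set1P; rewrite -[[set 1]]tixz inE mem_cycle andbT.
  rewrite -groupV (_ : _^-1 = x ^+ i) ?mem_cycle //.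
  by apply/eqP; rewrite eq_invg_mul -(cxzX i j) e.
by rewrite -ox -oz !order_dvdn zj -e zj mulg1 !eqxx.
Qed.

Let memH d i j : (d %| 2 * n)%N -> (x ^+ i * z ^+ j \in H d) = (d %| i)%N.
Proof.
move=> dv; apply/HP/idP => [[k [l e]]|/dvdnP[k ->]]; last first.
  by exists k, j; rewrite mulnC.
(* The factor 2n - 1 plays the role of -1 in exponents of x, and adding l inverts z^l; this keeps
   all exponents natural. *)
have : x ^+ ((2 * n - 1) * (d * k) + i) * z ^+ (j + l) = 1.
  rewrite !expgD mulgA -(mulgA _ (x ^+ i)) e mulgA -expgD -mulgA -expgD.
  rewrite -mulSnr (_ : (2 * n - 1).+1 = 2 * n)%N; last by lia.
  by rewrite expgM xn1 expg1n mul1g addnn -mul2n expgM z2 expg1n.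
case/xz_eq1 => /(dvdn_trans dv); rewrite dvdn_addr //.
by rewrite mulnCA dvdn_mulr.
Qed.

Let cardH d : (d %| 2 * n)%N -> #|H d| = (2 * n %/ d * 2)%N.
Proof.
move=> dv; rewrite /H cent_joinEr; last first.
  rewrite cycle_subG; apply/centP => _ /cycleP[i ->].
  by rewrite -expgM; apply/commute_sym/(cxzX _ 1).
rewrite TI_cardMg; last by apply/trivgP; rewrite -tixz setSI // cycle_subG mem_cycle.
by rewrite -![#|<[_]>|]/(#[_]) oz orderXdiv ox.
Qed.

Let yA : y \notin A.
Proof.
apply/negP => Ay; suff : (#|G| <= #|A|)%N by rewrite oG oA; lia.
apply: subset_leq_card; rewrite -genG join_subG !cycle_subG Ay andbT.
by apply/AP; exists 1%N, 0%N; rewrite mulg1.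
Qed.

Let AxG : A \subset G. Proof. exact: H_sub_G. Qed.

Let outside_div g h : g \in G -> h \in G -> g \notin A -> h \notin A -> g * h^-1 \in A.
Proof.
move=> /G_split/orP[->//|gy] /G_split/orP[->//|hy] _ _.
by rewrite -(mulgKV y g) -(mulgKV y h) invMg mulgA mulgK groupM // groupV.
Qed.

Let outsideP g : g \in G -> g \notin A -> exists i j, g = x ^+ i * z ^+ j * y.
Proof.
move=> /G_split/orP[->//|/AP[i [j e]] _].
by exists i, j; rewrite -e mulgKV.
Qed.

(** * The centre *)

Let centerI g : g \in A -> commute g y -> g \in 'Z(G).
Proof.
move=> Ag gy; rewrite inE (subsetP AxG) //= -genG centY inE; apply/andP; split.
  rewrite cent_cycle; apply/cent1P/A_comm => //.
  by apply/AP; exists 1%N, 0%N; rewrite mulg1.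
by rewrite cent_cycle; apply/cent1P.
Qed.

Let center_comm g h : g \in 'Z(G) -> h \in G -> commute g h.
Proof. by case/setIP => _ /centP; apply. Qed.

(** A central element a y with a in A would make y = a^-1 (a y) commute with x. Then x = x^-1 z, so
    x^2 z = 1, against the uniqueness of the normal form. *)
Let Z_sub_A c : c \in 'Z(G) -> c \in A.
Proof.
move=> Zc; apply/negPn/negP => nAc.
have [i [j e]] := outsideP _ (subsetP (center_sub G) _ Zc) nAc.
have Aij : x ^+ i * z ^+ j \in A by apply/AP; exists i, j.
have cxy : commute x y.
  rewrite (_ : y = (x ^+ i * z ^+ j)^-1 * c); last by rewrite e mulKg.
  apply: commuteM; last exact/commute_sym/center_comm.
  by apply/commuteV/A_comm => //; apply/AP; exists 1%N, 0%N; rewrite mulg1.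
have : x ^+ 2 * z ^+ 1 = 1.
  have : x ^ y = x by rewrite conjgE cxy mulKg.
  by rewrite xJy => ex; rewrite (expgS x 1) !expg1 -{2}ex mulKVg -z2.
by case/xz_eq1 => /dvdn_leq; lia.
Qed.

(** The centre is generated by x^m and z, where x^m = 1 for odd n. The order of x^m is q, half the
    order of the centre, and m is also the size of the classes outside A. *)
Let m := if odd n then (2 * n)%N else n.
Let q := if odd n then 1%N else 2.

Let mq : (m * q = 2 * n)%N. Proof. by rewrite /m /q; case: odd; lia. Qed.
Let m_dvd : (m %| 2 * n)%N. Proof. by rewrite -mq dvdn_mulr. Qed.

Let m_gt0 : (0 < m)%N. Proof. by rewrite /m; case: odd; lia. Qed.

(** The right-hand side is the condition x^(2i) z^i = 1, which says that y commutes with x^i z^j. *)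
Let m_dvdP i : (m %| i)%N = (2 * n %| 2 * i)%N && (2 %| i)%N.
Proof.
rewrite /m dvdn_pmul2l //; case: ifP => on.
  by rewrite Gauss_dvd ?coprime2n // andbC.
case: (boolP (n %| i)%N) => //= /(dvdn_trans _) -> //.
by rewrite dvdn2 on.
Qed.

Let centerE : 'Z(G) = H m :> {set gT}.
Proof.
apply/setP => a; apply/idP/idP => [Za|Ha].
  have /AP[i [j e]] := Z_sub_A _ Za; move: Za; rewrite e memH // => Za.
  have : (x ^+ i * z ^+ j) ^ y = x ^+ i * z ^+ j.
    by rewrite conjgE (center_comm _ _ Za Gy) mulKg.
  rewrite conjMg xXJy [_ ^ y]conjgE -(commuteX j cyz) mulKg => /mulIg exi.
  have : x ^+ (2 * i) * z ^+ i = 1.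
    by rewrite mul2n -addnn expgD -{2}exi mulKVg -expgD addnn -mul2n expgM z2 expg1n.
  by case/xz_eq1 => d1 d2; rewrite m_dvdP d1.
have Aa : a \in A.
  by case/HP: Ha => i [j ->]; apply/AP; exists (m * i)%N, j.
apply: centerI => //; have /AP[i [j e]] := Aa.
move: Ha; rewrite e memH // m_dvdP => /andP[/dvdnP[k ik] /dvdnP[l il]].
apply: commute_sym; apply: commuteM; last exact: commuteX.
rewrite /commute [RHS]conjgC xXJy {3}il (mulnC l) expgM z2 expg1n mulg1.
congr (_ * _); apply/eqP; rewrite eq_sym eq_invg_mul -expgD addnn -mul2n ik.
by rewrite (mulnC k) expgM xn1 expg1n.
Qed.

Let oZ : #|'Z(G)| = (2 * q)%N.
Proof. by rewrite centerE cardH // -mq mulKn ?m_gt0 // mulnC. Qed.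

Let B := H 2.

Let Z_sub_B c : c \in 'Z(G) -> c \in B.
Proof.
move=> Zc; have /AP[i [j e]] := Z_sub_A _ Zc.
by move: Zc; rewrite centerE e !memH // ?dvdn_mulr // m_dvdP => /andP[].
Qed.

Let oB : #|B| = (2 * n)%N.
Proof. by rewrite cardH ?dvdn_mulr // mulKn // mulnC. Qed.

Let B_sub_A b : b \in B -> b \in A.
Proof. by case/HP => i [j ->]; apply/AP; exists (2 * i)%N, j. Qed.

(** * Labels of the three components *)

Let label (g : gT) : 'I_3 :=
  if g \in A then ord0 else if g \in B :* y then lift ord0 ord0 else ord_max.

Let By_outside g : g \in B :* y -> g \notin A.
Proof.
rewrite mem_rcoset => /B_sub_A Agy; apply: contra yA => Ag.
by rewrite -groupV -(groupMl _ Ag).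
Qed.

(** Outside A, conjugation by powers of x moves the exponent of x by even steps, so it can be
    brought down to its parity, which is what membership in B y detects. *)
Let conj_x i j k : (x ^+ (i + 2 * k) * z ^+ j * y) ^ (x ^+ k) = x ^+ i * z ^+ (j + k) * y.
Proof.
have ey : y ^ (x ^+ k) = x ^- (2 * k) * z ^+ k * y.
  by rewrite conjgE mul_yxX mul2n -addnn expgD invMg !mulgA.
have ea : (x ^+ (i + 2 * k) * z ^+ j) ^ (x ^+ k) = x ^+ (i + 2 * k) * z ^+ j.
  have Ak : x ^+ k \in A by apply/AP; exists k, 0%N; rewrite mulg1.
  by rewrite conjgE (A_comm _ (x ^+ k)) ?mulKg //; apply/AP; exists (i + 2 * k)%N, j.
rewrite conjMg ea ey !mulgA -(mulgA _ (z ^+ j)).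
rewrite (commuteV (commute_sym (cxzX (2 * k) j))) expgD.
by rewrite !mulgA mulgK -(mulgA (x ^+ i)) -expgD.
Qed.

Let conj_rep g : g \in G -> g \notin A ->
  exists k j, g ^ (x ^+ k) = x ^+ (g \notin B :* y) * z ^+ j * y.
Proof.
move=> Gg Ag; have [i [j ->]] := outsideP _ Gg Ag.
rewrite mem_rcoset mulgK memH ?dvdn_mulr // dvdn2 negbK.
exists i./2, (j + i./2)%N.
by rewrite -{1}(odd_double_half i) -mul2n conj_x.
Qed.

Let normA : G \subset 'N(A).
Proof.
apply: normal_norm; apply: index2_normal => //.
by rewrite -divgS // oA oG -(mulnA 2 4) mulnK //; lia.
Qed.

Let normBy : G \subset 'N(B :* y).
Proof.
rewrite -genG join_subG !cycle_subG !inE; apply/andP; split.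
  apply/subsetP => _ /imsetP[_ /rcosetP[_ /HP[i [j ->]] ->] ->].
  (* Adding the period 2n leaves room to subtract 2 in the naturals, so that [conj_x] applies with k
     = 1 even when i = 0. *)
  rewrite (_ : x ^+ (2 * i) = x ^+ (2 * (i + n - 1) + 2 * 1)); last first.
    rewrite (_ : 2 * (i + n - 1) + 2 * 1 = 2 * i + 2 * n)%N; last by lia.
    by rewrite (expgD x (2 * i)) xn1 mulg1.
  have := conj_x (2 * (i + n - 1)) j 1; rewrite expg1 => ->.
  by rewrite mem_rcoset mulgK; apply/HP; exists (i + n - 1)%N, (j + 1)%N.
apply/subsetP => _ /imsetP[_ /rcosetP[_ /HP[i [j ->]] ->] ->].
rewrite mem_rcoset 2!conjMg (conjgE y y) mulKg mulgK xXJy [(z ^+ j) ^ y]conjgE.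
rewrite -(commuteX j cyz) mulKg !groupM ?groupV ?zH //.
by apply/HP; exists i, 0%N; rewrite mulg1.
Qed.

Let labelJ g h : h \in G -> label (g ^ h) = label g.
Proof.
move=> Gh; rewrite /label !memJ_norm //.
  exact: subsetP normBy _ Gh.
exact: subsetP normA _ Gh.
Qed.

(** Write h = a y with a in A. As A is abelian, g commutes with a, hence with y = a^-1 h, and
    [centerI] applies. *)
Let comm_outside g h : g \in G -> h \in G -> g \in A -> h \notin A ->
  commute g h -> g \in 'Z(G).
Proof.
move=> Gg Gh Ag Ah cgh; have [i [j eh]] := outsideP _ Gh Ah; apply: centerI => //.
rewrite (_ : y = (x ^+ i * z ^+ j)^-1 * h); last by rewrite eh mulKg.
apply: commuteM => //; apply/commuteV/A_comm => //.
by apply/AP; exists i, j.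
Qed.

Let comm_outside2 g h : g \in G -> h \in G -> g \notin A -> h \notin A ->
  commute g h -> g * h^-1 \in 'Z(G).
Proof.
move=> Gg Gh Ag Ah cgh; apply: (comm_outside _ h) => //.
- by rewrite groupM ?groupV.
- exact: outside_div.
by apply: commute_sym; apply: commuteM; [exact: commute_sym | exact/commuteV].
Qed.

Let label_comm g h : g \in G :\: 'Z(G) -> h \in G :\: 'Z(G) -> commute g h ->
  label g = label h.
Proof.
rewrite !in_setD => /andP[Zg Gg] /andP[Zh Gh] cgh; rewrite /label.
case: (boolP (g \in A)) => Ag; case: (boolP (h \in A)) => Ah //.
- by rewrite (comm_outside g h) in Zg.
- by rewrite (comm_outside h g) ?(commute_sym cgh) in Zh.
congr (if _ then _ else _); rewrite !mem_rcoset.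
by rewrite -(mulgKV h g) -mulgA groupMl // Z_sub_B // comm_outside2.
Qed.

(** Outside A, [conj_rep] turns both elements into x^b y times powers of z, with the same b; these
    commute because z commutes with x and y. *)
Let label_conj g h : g \in G -> h \in G -> label g = label h ->
  exists k l, commute (g ^ (x ^+ k)) (h ^ (x ^+ l)).
Proof.
move=> Gg Gh; rewrite /label.
case: (boolP (g \in A)) => Ag; case: (boolP (h \in A)) => Ah.
- by move=> _; exists 0%N, 0%N; rewrite expg0 !conjg1; apply: A_comm.
- by case: ifP.
- by case: ifP.
move=> e; have {e} eB : (h \in B :* y) = (g \in B :* y) by move: e; do 2!case: ifP.
have [k [i ek]] := conj_rep _ Gg Ag; have [l [j el]] := conj_rep _ Gh Ah.
exists k, l; rewrite ek el eB; move: (nat_of_bool _) => b.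
have cz c : commute (x ^+ b * y) (z ^+ c).
  apply: commute_sym; apply: commuteM; first exact/commute_sym/cxzX.
  exact/commute_sym/commuteX.
rewrite -!(mulgA (x ^+ b)) -!(commuteX _ cyz) !(mulgA (x ^+ b)).
apply: commuteM; apply: commute_sym; apply: commuteM => //; try exact: cz.
  exact/commute_sym/cz.
exact: commuteX2.
Qed.

(** * Counting conjugacy classes *)

Let E l := [set g in G :\: 'Z(G) | label g == l].

Let label_eq0 g : (label g == ord0) = (g \in A).
Proof. by rewrite /label; case: (g \in A) => //; case: ifP. Qed.

Let nonZJ g h : h \in G -> (g ^ h \in G :\: 'Z(G)) = (g \in G :\: 'Z(G)).
Proof.
move=> Gh; rewrite !in_setD memJ_norm ?groupJr //.
by apply: subsetP Gh; apply: gFnorm.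
Qed.

Let class_partition l : partition [set g ^: G | g in E l] (E l).
Proof.
apply: (@orbit_partition _ _ _ 'J G (E l)); rewrite astabsJ.
apply/subsetP => h Gh; rewrite inE; apply/subsetP => _ /imsetP[g + ->].
by rewrite in_set [_ ^ _ \in E l]in_set nonZJ // labelJ.
Qed.

(** The class size is the index of the centraliser. For noncentral g in A the centraliser is A, of
    index 2; for g outside A it is the union of the cosets Z and Z g of the centre Z, of order 4q,
    and 8n = 4q m. *)
Let card_class g l : g \in E l -> #|g ^: G| = (if l == ord0 then 2 else m).
Proof.
rewrite in_set in_setD => /andP[/andP[Zg Gg] /eqP <-]; rewrite label_eq0 -index_cent1.
apply/eqP; rewrite -(eqn_pmul2l (cardG_gt0 'C_G[g])) Lagrange ?subsetIl //.
rewrite oG /=; case: ifP => Ag.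
  suff -> : 'C_G[g] = A :> {set gT} by rewrite oA; lia.
  apply/setP => h; rewrite inE cent1C; apply/andP/idP => [[Gh /cent1P cgh]|Ah].
    by apply/negPn/negP => nAh; case/negP: Zg; apply: comm_outside cgh.
  by split; [apply: (subsetP AxG) | apply/cent1P/A_comm].
suff -> : #|'C_G[g]| = (2 * #|'Z(G)|)%N by rewrite oZ; have := mq; lia.
have -> : 'C_G[g] = 'Z(G) :|: 'Z(G) :* g :> {set gT}.
  apply/setP => h; rewrite in_setU mem_rcoset inE.
  apply/andP/orP => [[Gh /cent1P cgh]|Zh].
    case: (boolP (h \in A)) => Ah; [left | right].
      by apply: (comm_outside _ g) => //; rewrite ?Ag.
    by apply: comm_outside2 => //; rewrite ?Ag.
  case: Zh => Zh.
    split; first exact: (subsetP (center_sub G)).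
    exact/cent1P/center_comm.
  have cg : commute g (h * g^-1) by exact/commute_sym/center_comm.
  rewrite -(mulgKV g h); split; first by rewrite groupM // (subsetP (center_sub G)).
  by apply/cent1P/commute_sym; apply: commuteM.
have dZ : 'Z(G) :&: 'Z(G) :* g = set0.
  apply: disjoint_setI0; rewrite disjoint_subset; apply/subsetP => c Zc.
  rewrite inE mem_rcoset; apply/negP => /Z_sub_A Acg; case/negP: (Ag).
  by rewrite -groupV -(groupMl _ (Z_sub_A _ Zc)).
by rewrite cardsU dZ card_rcoset cards0 subn0 addnn mul2n.
Qed.

Let card_E l : #|E l| = (if l == ord0 then 4 * n - 2 * q else 2 * n)%N.
Proof.
have AB : [disjoint A & B :* y].
  by rewrite disjoint_sym disjoint_subset; apply/subsetP => g; exact: By_outside.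
have ZA : 'Z(G) \subset A by apply/subsetP => c; exact: Z_sub_A.
have GA : G :\: 'Z(G) :\: A = G :\: A by rewrite setDDl (setUidPr ZA).
have ByGA : B :* y \subset G :\: A.
  rewrite subsetD disjoint_sym AB andbT; apply/subsetP => _ /rcosetP[b /B_sub_A Ab ->].
  by rewrite groupM // (subsetP AxG).
have ByA g : g \in B :* y -> (g \in A) = false by move=> /By_outside/negPf.
have lE g : val (label g) = (if g \in A then 0 else if g \in B :* y then 1 else 2)%N.
  by rewrite /label; do 2?case: (_ \in _).
case: l => [[|[|[|l]]] lt_l] //.
- have -> : E (Ordinal lt_l) = A :\: 'Z(G).
    apply/setP => g; rewrite in_set !in_setD -val_eqE lE -andbA; congr (_ && _).
    case: (boolP (g \in A)) => [/(subsetP AxG)-> //|_].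
    by case: (g \in B :* y); rewrite andbF.
  by rewrite cardsD (setIidPr ZA) oA oZ.
- have -> : E (Ordinal lt_l) = B :* y.
    apply/setP => g; rewrite in_set -val_eqE lE.
    case: (boolP (g \in B :* y)) => [gB|_]; last by case: ifP; rewrite andbF.
    have := subsetP ByGA _ gB; rewrite ByA // -GA in_setD => /andP[_ ->].
    by [].
  by rewrite card_rcoset oB.
have -> : E (Ordinal lt_l) = (G :\: A) :\: (B :* y).
  apply/setP => g; rewrite in_set -val_eqE lE -GA !in_setD.
  by case: (g \in A); case: (g \in B :* y); rewrite ?andbF ?andbT.
by rewrite cardsD (setIidPr ByGA) card_rcoset oB cardsD (setIidPr AxG) oG oA -!mulnBl.
Qed.

Let card_classes l :
  #|[set g ^: G | g in E l]| = (if l == ord0 then 2 * n - q else q)%N.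
Proof.
have uni : {in [set g ^: G | g in E l], forall X : {set gT},
    #|X| = if l == ord0 then 2 else m}.
  by move=> _ /imsetP[g Eg ->]; apply: card_class Eg.
have := card_uniform_partition uni (class_partition l); rewrite card_E.
have := mq; have := m_gt0; move: #|_| => k.
by case: (l == ord0) => mp mqE; nia.
Qed.

Lemma CCC_V8n_cluster : exists f : vertex (CCC G) -> 'I_3,
  (forall u v, adj (CCC G) u v = (u != v) && (f u == f v)) /\
  (forall l, #|[set v | f v == l]| = (if l == ord0 then 2 * n - q else q)%N).
Proof.
(* Labels are invariant under conjugation, so the choice of representative is immaterial; this is
   [fE] below. *)
pose f (v : vertex (CCC G)) := label (repr (val v)).
have repP (v : vertex (CCC G)) : exists2 g, g \in G :\: 'Z(G) & val v = g ^: G.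
  by case: v => X /= XV; have /imsetP[g] := XV; exists g.
have fE (v : vertex (CCC G)) g : g \in val v -> f v = label g.
  have [h _ eX] := repP v; rewrite /f eX => /imsetP[b Gb ->].
  have /imsetP[a Ga ->] := mem_repr h (class_refl G h).
  by rewrite !labelJ.
have nonZ (v : vertex (CCC G)) g : g \in val v -> g \in G :\: 'Z(G).
  by have [h nZh ->] := repP v => /imsetP[a Ga ->]; rewrite nonZJ.
exists f; split=> [u v|l].
  rewrite /= /ccc_adj; congr (_ && _).
  apply/existsP/eqP => [[g /andP[ug /existsP[h /andP[vh /eqP cgh]]]]|].
    by rewrite (fE u g ug) (fE v h vh); apply: label_comm (nonZ _ _ ug) (nonZ _ _ vh) cgh.
  have [g Gg eu] := repP u; have [h Gh ev] := repP v.
  rewrite (fE u g) ?(fE v h) ?eu ?ev ?class_refl // => lgh.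
  have [||k [l c]] := label_conj g h _ _ lgh; [by case/setDP: Gg | by case/setDP: Gh|].
  exists (g ^ (x ^+ k)); rewrite memJ_class ?groupX //.
  by apply/existsP; exists (h ^ (x ^+ l)); rewrite memJ_class ?groupX //; apply/eqP.
rewrite -card_classes -(card_imset _ val_inj); apply: eq_card => X.
apply/imsetP/imsetP => [[v]|[g]]; rewrite inE.
  move=> /eqP fv ->; have [g Gg ev] := repP v; exists g => //.
  by rewrite inE Gg -(fE v) ?ev ?class_refl ?fv /=.
move=> /andP[Gg /eqP lg] eX.
have XV : X \in noncentral_classes G by apply/imsetP; exists g.
exists (Sub X XV : vertex (CCC G)) => //.
by rewrite inE (fE _ g) ?lg //= eX class_refl.
Qed.

End V8nStructure.

Lemma CCC_of_V8n n (gT : finGroupType) (G : {group gT}) :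
    (2 <= n)%N -> is_V8n n G ->
  exists f : vertex (CCC G) -> 'I_3,
  (forall u v, adj (CCC G) u v = (u != v) && (f u == f v)) /\
  (forall l, #|[set v | f v == l]| =
     (if l == ord0 then 2 * n - (if odd n then 1 else 2)
      else if odd n then 1 else 2)%N).
Proof.
move=> n_ge2 isoG; have n_gt0 : (0 < n)%N by lia.
(* The model satisfies the relations, so it is a homomorphic image of G, whose order is therefore at
   least 8n. *)
have := V8n_model_homg n n_gt0; rewrite -isoG => /card_homg/dvdn_leq.
move=> /(_ (cardG_gt0 G))/(leq_trans (V8n_model_card n n_gt0)) leG.
have /existsP[[x y] /= /eqP[genG xn1 y41 yx yVx]] := isoGrp_hom isoG.
exact: (CCC_V8n_cluster n _ _ x y).
Qed.

(** * Spectra and energies *)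

Lemma flatten_map_I3 (T : Type) (F : 'I_3 -> seq T) :
  flatten [seq F l | l <- enum 'I_3] = F ord0 ++ F (lift ord0 ord0) ++ F ord_max.
Proof.
rewrite !enum_ordSl (size0nil (size_enum_ord 0)) /= cats0.
by congr (_ ++ _ ++ F _); apply: val_inj.
Qed.

Lemma sumr_nseq (V : nmodType) (T : Type) k (a : T) (F : T -> V) :
  \sum_(c <- nseq k a) F c = F a *+ k.
Proof. by rewrite big_nseq iter_addr_0. Qed.

(** Absolute values in the energies are resolved by exhibiting each term as plus or minus a ratio of
    naturals, so no inequality has to be proved in [C]. *)
Lemma normr_ratio (C : numClosedFieldType) (c : C) (a b : nat) :
  c = a%:R / b%:R -> `|c| = a%:R / b%:R.
Proof. by move->; rewrite ger0_norm // divr_ge0 ?ler0n. Qed.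

Lemma normr_ratioN (C : numClosedFieldType) (c : C) (a b : nat) :
  c = - (a%:R / b%:R) -> `|c| = a%:R / b%:R.
Proof. by move->; rewrite normrN; apply: normr_ratio. Qed.

(** The side conditions of [field] are nonvanishing denominators; the rewrites gather each into the
    cast of a single natural number, which [lia] shows nonzero. *)
Ltac nat_field :=
  field; repeat (apply/andP; split); repeat split;
  do 3 rewrite ?natr1 ?nat1r -?(natrD, natrM); rewrite pnatr_eq0; lia.

Theorem theorem3p4 (C : numClosedFieldType) (n : nat) (gT : finGroupType)
    (G : {group gT}) (n_ge2 : (2 <= n)%N) (G_V8n : is_V8n n G) :
  (perm_eq (Spec C (CCC G))
     (if odd n
      then nseq (2 * n - 2) (-1) ++ nseq 2 0 ++ nseq 1 (2 * n%:R - 2)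
      else nseq (2 * n - 1) (-1) ++ nseq 2 1 ++ nseq 1 (2 * n%:R - 3))
   /\ energy C (CCC G) = (if odd n then 4 * n%:R - 4 else 4 * n%:R - 2))
  /\
  (perm_eq (LSpec C (CCC G))
     (if odd n
      then nseq 3 0 ++ nseq (2 * n - 2) (2 * n%:R - 1)
      else nseq 3 0 ++ nseq 2 2 ++ nseq (2 * n - 3) (2 * n%:R - 2))
   /\ Lenergy C (CCC G) =
        (if odd n
         then 6 * (2 * n%:R - 1) * (2 * n%:R - 2) / (2 * n%:R + 1)
         else if n == 2%N then 6
         else 2 * (2 * n%:R - 3) * (5 * n%:R - 7) / (n%:R + 1)))
  /\
  (perm_eq (QSpec C (CCC G))
     (if odd n
      then nseq 2 0 ++ nseq 1 (4 * n%:R - 4) ++ nseq (2 * n - 2) (2 * n%:R - 3)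
      else nseq 2 2 ++ nseq 2 0 ++ nseq 1 (4 * n%:R - 6)
             ++ nseq (2 * n - 3) (2 * n%:R - 4))
   /\ Qenergy C (CCC G) =
        (if odd n
         then 4 * (2 * n%:R - 1) * (2 * n%:R - 2) / (2 * n%:R + 1)
         else if n == 2%N then 6
         else 16 * (n%:R - 1) * (n%:R - 2) / (n%:R + 1))).
Proof.
have [f [adjE]] := CCC_of_V8n _ _ _ n_ge2 G_V8n.
case: ifP => n_odd card_f.
- have [k en] : exists k, n = k.+3.
    by exists (n - 3)%N; move: n_ge2 n_odd; case: (n) => [|[|[|]]] // *; lia.
  have en2 : (2 * n - 2 = 2 * k + 4)%N by lia.
  (* For odd n the complete graphs have 2n - 1 = 2k + 5, 1 and 1 vertices; [sz] gives their
     degrees. *)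
  pose sz (l : 'I_3) := if l == ord0 then (2 * k + 4)%N else 0%N.
  have card_sz l : #|[set v | f v == l]| = (sz l).+1.
    by rewrite card_f /sz en; case: ifP; lia.
  have pS : perm_eq (Spec C (CCC G))
      (nseq (2 * n - 2) (-1) ++ nseq 2 0 ++ nseq 1 (2 * n%:R - 2)).
    apply: perm_trans (perm_Spec_cluster C _ _ f sz adjE card_sz) _.
    rewrite flatten_map_I3 /sz /= (_ : 0%:R = 0 :> C) //.
    have -> : 2 * n%:R - 2 = (2 * k + 4)%:R :> C by rewrite en; ring.
    (* Two lists are permutations of each other when every predicate has the same count in both,
       which leaves an identity of naturals. *)
    apply/seq.permP => P; rewrite en2 -cats1 !count_cat /= !count_nseq.
    rewrite !addn0; ring.
  have pL : perm_eq (LSpec C (CCC G)) (nseq 3 0 ++ nseq (2 * n - 2) (2 * n%:R - 1)).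
    apply: perm_trans (perm_LSpec_cluster C _ _ f sz adjE card_sz) _.
    rewrite flatten_map_I3 /sz /=.
    have -> : 2 * n%:R - 1 = (2 * k + 4).+1%:R :> C by rewrite en; ring.
    apply/seq.permP => P; rewrite en2 -cats1 !count_cat /= !count_nseq.
    rewrite !addn0; ring.
  have pQ : perm_eq (QSpec C (CCC G))
      (nseq 2 0 ++ nseq 1 (4 * n%:R - 4) ++ nseq (2 * n - 2) (2 * n%:R - 3)).
    apply: perm_trans (perm_QSpec_cluster C _ _ f sz adjE card_sz) _.
    rewrite flatten_map_I3 /sz /=.
    have -> : 4 * n%:R - 4 = (2 * (2 * k + 4))%:R :> C by rewrite en; ring.
    have -> : 2 * n%:R - 3 = (2 * k + 4)%:R - 1 :> C by rewrite en; ring.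
    apply/seq.permP => P.
    rewrite en2 -cats1 !count_cat /= !count_nseq muln0 (_ : 0%:R = 0 :> C) //.
    rewrite !addn0; ring.
  have dE : avg_degree C (CCC G) = ((2 * k + 5) * (2 * k + 4))%:R / (2 * k + 7)%:R.
    rewrite (avg_degree_cluster C _ _ f sz adjE card_sz) !big_ord_recl !big_ord0 /sz /=.
    by congr (_%:R / _%:R); lia.
  split; [split=> // | split; split=> //].
  + rewrite /energy (perm_big _ pS) !big_cat !sumr_nseq /= en2 en.
    rewrite normrN1 normr0 (normr_ratio _ _ (2 * k + 4) 1); last by nat_field.
    by nat_field.
  + rewrite /Lenergy dE (perm_big _ pL) !big_cat !sumr_nseq /= en2 en.
    rewrite (normr_ratioN _ _ ((2 * k + 5) * (2 * k + 4)) (2 * k + 7)); last by nat_field.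
    rewrite (normr_ratio _ _ (3 * (2 * k + 5)) (2 * k + 7)); last by nat_field.
    by nat_field.
  rewrite /Qenergy dE (perm_big _ pQ) !big_cat !sumr_nseq /= en2 en.
  rewrite (normr_ratioN _ _ ((2 * k + 5) * (2 * k + 4)) (2 * k + 7)); last by nat_field.
  rewrite (normr_ratio _ (4 * _ - _ - _) ((2 * k + 4) * (2 * k + 9)) (2 * k + 7));
    last by nat_field.
  (* This is 2n - 3 - d, which is positive because n = k + 3. *)
  rewrite (normr_ratio _ _ (2 * k + 1) (2 * k + 7)); last by nat_field.
  by nat_field.
have [k en] : exists k, n = k.+2 by exists n.-2; lia.
have en1 : (2 * n - 1 = 2 * k + 3)%N by lia.
have en3 : (2 * n - 3 = 2 * k + 1)%N by lia.
(* For even n the complete graphs have 2n - 2 = 2k + 2, 2 and 2 vertices. *)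
pose sz (l : 'I_3) := if l == ord0 then (2 * k + 1)%N else 1%N.
have card_sz l : #|[set v | f v == l]| = (sz l).+1.
  by rewrite card_f /sz en; case: ifP; lia.
have pS : perm_eq (Spec C (CCC G))
    (nseq (2 * n - 1) (-1) ++ nseq 2 1 ++ nseq 1 (2 * n%:R - 3)).
  apply: perm_trans (perm_Spec_cluster C _ _ f sz adjE card_sz) _.
  rewrite flatten_map_I3 /sz /=.
  have -> : 2 * n%:R - 3 = (2 * k + 1)%:R :> C by rewrite en; ring.
  apply/seq.permP => P; rewrite ?(en1, en3) -cats1 !count_cat /= !count_nseq.
  rewrite !addn0; ring.
have pL : perm_eq (LSpec C (CCC G))
    (nseq 3 0 ++ nseq 2 2 ++ nseq (2 * n - 3) (2 * n%:R - 2)).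
  apply: perm_trans (perm_LSpec_cluster C _ _ f sz adjE card_sz) _.
  rewrite flatten_map_I3 /sz /=.
  have -> : 2 * n%:R - 2 = (2 * k + 1).+1%:R :> C by rewrite en; ring.
  apply/seq.permP => P; rewrite ?(en1, en3) -cats1 !count_cat /= !count_nseq.
  rewrite !addn0; ring.
have pQ : perm_eq (QSpec C (CCC G))
    (nseq 2 2 ++ nseq 2 0 ++ nseq 1 (4 * n%:R - 6) ++ nseq (2 * n - 3) (2 * n%:R - 4)).
  apply: perm_trans (perm_QSpec_cluster C _ _ f sz adjE card_sz) _.
  rewrite flatten_map_I3 /sz /= subrr muln1.
  have -> : 4 * n%:R - 6 = (2 * (2 * k + 1))%:R :> C by rewrite en; ring.
  have -> : 2 * n%:R - 4 = (2 * k + 1)%:R - 1 :> C by rewrite en; ring.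
  apply/seq.permP => P; rewrite ?(en1, en3) -cats1 !count_cat /= !count_nseq.
  rewrite !addn0; ring.
have dE : avg_degree C (CCC G) =
    (2 * k * k + 3 * k + 3)%:R / (k + 3)%:R.
  rewrite (avg_degree_cluster C _ _ f sz adjE card_sz) !big_ord_recl !big_ord0 /sz /=.
  by nat_field.
split; [split=> // | split; split=> //].
+ rewrite /energy (perm_big _ pS) !big_cat !sumr_nseq /= en1 en.
  rewrite normrN1 normr1 (normr_ratio _ _ (2 * k + 1) 1); last by nat_field.
  by nat_field.
+ rewrite /Lenergy dE (perm_big _ pL) !big_cat !sumr_nseq /= en3 en.
  rewrite (normr_ratioN _ (0 - _) (2 * k * k + 3 * k + 3) (k + 3)); last by nat_field.
  rewrite (normr_ratio _ (2 * _ - _ - _) (5 * k + 3) (k + 3)); last by nat_field.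
  (* Here 2 - d = (1 - k)(2k + 3) / (k + 3) is positive only for k = 0, which is why n = 2 has its
     own formula. *)
  case: (k) => [|j] /=.
    by rewrite (normr_ratio _ _ 1 1); nat_field.
  rewrite (normr_ratioN _ _ (2 * j * j + 5 * j) (j + 4)); last by nat_field.
  by nat_field.
rewrite /Qenergy dE (perm_big _ pQ) !big_cat !sumr_nseq /= en3 en.
rewrite (normr_ratioN _ (0 - _) (2 * k * k + 3 * k + 3) (k + 3)); last by nat_field.
rewrite (normr_ratio _ (4 * _ - _ - _) (2 * k * k + 11 * k + 3) (k + 3)); last by nat_field.
(* Besides 2 - d, the term 2n - 4 - d = 3(k - 1) / (k + 3) also changes sign here: it is -1 for k =
   0 and nonnegative afterwards. *)
case: (k) => [|j] /=.
  rewrite (normr_ratio _ (2 - _) 1 1); last by nat_field.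
  by rewrite (normr_ratioN _ _ 1 1); nat_field.
rewrite (normr_ratioN _ (2 - _) (2 * j * j + 5 * j) (j + 4)); last by nat_field.
rewrite (normr_ratio _ _ (3 * j) (j + 4)); last by nat_field.
by nat_field.
Qed.
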